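(* Let $x=(x_1,\ldots,x_n)$ and let $\lambda$ be a single parameter variable ($r=1$). Let $F(x,\lambda)=F_0(x)+\lambda F_1(x)$ be a symmetric $p\times p$ polynomial matrix and, for $i=1,\ldots,m$, let $G_i(x,\lambda)=G_{i0}(x)+\lambda G_{i1}(x)$ be a symmetric $q_i\times q_i$ polynomial matrix. Suppose that the restricted matrix quadratic module $\mathfrak M_x^p(G)$ is restricted Archimedean. If $F(x,\lambda)\succ 0$ for every $(x,\lambda)\in K_G=\{(x,\lambda)\in\mathbb R^n\times\mathbb R: G_i(x,\lambda)\succeq 0,\ i=1,\ldots,m\}$, then $F\in\mathfrak M_x^p(G)$.
   Context: $\mathcal V_1=\{p_0(x)+\lambda p_1(x):p_0,p_1\in\mathbb R[x]\}$. $\mathbb S^p$ is the space of real symmetric $p\times p$ matrices, and $\mathbb S^p\otimes\mathcal V_1$ is the space of symmetric $p\times p$ polynomial matrices with entries in $\mathcal V_1$. $\Sigma^p[x]$ is the cone of SOS polynomial matrices: $S\in\Sigma^p[x]$ if $S=P^{\intercal}P$ for some polynomial matrix $P$ in $x$ with $p$ columns. The restricted matrix quadratic module is $$\mathfrak M_x^p(G)=\Big\{S_0+\sum_{i=1}^m\sum_\nu H_{i\nu}^{\intercal}G_iH_{i\nu}: S_0\in\Sigma^p[x],\ H_{i\nu}\in\mathbb R[x]^{q_i\times p}\Big\}\subseteq\mathbb S^p\otimes\mathcal V_1,$$ where the sums over $\nu$ are finite. It is restricted Archimedean if $I_p$ is an order unit in $\mathbb S^p\otimes\mathcal V_1$: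 for every $P\in\mathbb S^p\otimes\mathcal V_1$ there is $N>0$ with $NI_p+P,\ NI_p-P\in\mathfrak M_x^p(G)$. *)

(* Defs.v *)
From HB Require Import structures.
From mathcomp Require Import all_boot all_order all_algebra.
(* mpoly must be imported before any file of mathcomp-analysis: in the other
   order the notation levels clash. *)
From mathcomp Require Import mpoly.
From mathcomp Require Import classical_sets reals.

Set Implicit Arguments.
Unset Strict Implicit.
Unset Printing Implicit Defensive.

Import Order.TTheory GRing.Theory Num.Theory.
Local Open Scope ring_scope.

(* R[x][lambda], with x = (x_1, ..., x_n): the polynomial variable 'X plays the role of lambda. *)
Notation xlpoly R n := {poly {mpoly R[n]}}.

Section Definitions.
Variables (R : realType) (n : nat).

Definition affine_in_lambda (f : xlpoly R n) : Prop :=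
  exists p0 p1 : {mpoly R[n]}, f = p0%:P + 'X * p1%:P.

Definition sym_affine p (F : 'M[xlpoly R n]_p) : Prop :=
  F^T = F /\ forall i j, affine_in_lambda (F i j).

Definition const_in_lambda p q (A : 'M[{mpoly R[n]}]_(p, q)) :
  'M[xlpoly R n]_(p, q) := map_mx polyC A.

Definition pencil p (F0 F1 : 'M[{mpoly R[n]}]_p) : 'M[xlpoly R n]_p :=
  const_in_lambda F0 + 'X *: const_in_lambda F1.

Definition eval_xl (x : 'rV[R]_n) (l : R) (f : xlpoly R n) : R :=
  (map_poly (meval (x 0)) f).[l].

Definition eval_mx p q (x : 'rV[R]_n) (l : R) (A : 'M[xlpoly R n]_(p, q)) :
  'M[R]_(p, q) := map_mx (eval_xl x l) A.

Definition psd p (A : 'M[R]_p) : Prop :=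
  A^T = A /\ forall v : 'cV[R]_p, 0 <= (v^T *m A *m v) 0 0.

Definition pd p (A : 'M[R]_p) : Prop :=
  A^T = A /\ forall v : 'cV[R]_p, v != 0 -> 0 < (v^T *m A *m v) 0 0.

Definition sos_mx p (S : 'M[{mpoly R[n]}]_p) : Prop :=
  exists (k : nat) (P : 'M[{mpoly R[n]}]_(k, p)), S = P^T *m P.

Section QuadraticModule.
Variables (m : nat) (q : 'I_m -> nat) (G : forall i, 'M[xlpoly R n]_(q i)).

Definition semialg_set : set ('rV[R]_n * R) :=
  [set z | forall i, psd (eval_mx z.1 z.2 (G i))]%classic.

(* The sum over nu is finite, with a length [k i] depending on i; the
   multipliers [H i nu] do not involve lambda. *)
Definition restricted_qm p : set 'M[xlpoly R n]_p :=
  [set T | exists (S0 : 'M[{mpoly R[n]}]_p) (k : 'I_m -> nat)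
      (H : forall i, 'I_(k i) -> 'M[{mpoly R[n]}]_(q i, p)),
    sos_mx S0 /\
    T = const_in_lambda S0 +
        \sum_(i < m) \sum_(nu < k i)
          (const_in_lambda (H i nu))^T *m G i *m const_in_lambda (H i nu)
  ]%classic.

Definition restricted_archimedean p : Prop :=
  forall P : 'M[xlpoly R n]_p, sym_affine P ->
  exists N : R, 0 < N /\
    restricted_qm ((N%:MP)%:P%:M + P) /\
    restricted_qm ((N%:MP)%:P%:M - P).

End QuadraticModule.
End Definitions.

(* Main.v *)
(* Let V be the real vector space of pairs (A0, A1), i.e. of the matrices
   A0 + lambda A1, and M the cone of those whose symmetrization lies in the
   restricted quadratic module. As I is an order unit of M and V has countable
   dimension, an F outside M is separated from M by an extreme state L with
   L F <= 0. The cone M is stable under congruences, so an operator that is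
   symmetric for L, such as multiplication by a polynomial in x, acts boundedly
   and, L being extreme, as a scalar; hence L factors through evaluation at a
   point x of R^n: L (A0, A1) = tr (S0 A0(x)) + tr (S1 A1(x)). With a single
   lambda, "multiplication by lambda" is one more symmetric operator, namely T
   with S1 = S0 T, so S1 = mu S0; extremality finally makes S0 of rank one.
   Thus L P = v^T P(x, mu) v / |v|^2 with (x, mu) in K_G, contradicting
   the positivity of F there. *)
Require Import Defs.
From HB Require Import structures.
From mathcomp Require Import all_boot all_order all_algebra.
From mathcomp Require Import mpoly.
From mathcomp Require Import classical_sets reals boolp.
From mathcomp Require Import ring lra.

Set Implicit Arguments.
Unset Strict Implicit.
Unset Printing Implicit Defensive.

Import Order.TTheory GRing.Theory Num.Theory.
Local Open Scope ring_scope.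

(** * Pure states of an order unit cone *)

Section OrderUnit.
Variables (R : realType) (V : lmodType R).
Implicit Types (C M : V -> Prop) (u v e f : V).

Definition convex_cone C :=
  (forall u v, C u -> C v -> C (u + v)) /\
  (forall k v, 0 <= k -> C v -> C (k *: v)).

Definition order_unit C e := C e /\ forall v, exists k, C (k *: e - v).

Definition positive C (L : V -> R) := forall v, C v -> 0 <= L v.

(** Extremality is put in terms of domination: a positive functional below a multiple of [L] is
    proportional to [L], and evaluating at [e] identifies the factor as [L1 e]. *)
Definition pure_state C e (L : {scalar V}) :=
  [/\ positive C L, L e = 1 &
    forall (L1 : {scalar V}) (c : R), positive C L1 ->
      (forall v, C v -> L1 v <= c * L v) -> forall v, L1 v = L1 e * L v].

(** Linear spanning, phrased as an induction principle. *)
Definition generating (I : Type) (b : I -> V) := forall P : V -> Prop,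
  P 0 -> (forall u v, P u -> P v -> P (u + v)) ->
  (forall k v, P v -> P (k *: v)) -> (forall i, P (b i)) -> forall v, P v.

Lemma cone_add C u v : convex_cone C -> C u -> C v -> C (u + v).
Proof. by move=> [+ _]; apply. Qed.

Lemma cone_scale C k v : convex_cone C -> 0 <= k -> C v -> C (k *: v).
Proof. by move=> [_]; apply. Qed.

Lemma proper_cone_unit C e k : convex_cone C -> ~ C (- e) ->
  C (k *: e) -> 0 <= k.
Proof.
move=> cC Ne Ck; rewrite leNgt; apply/negP => k0; apply: Ne.
have -> : - e = (- k)^-1 *: (k *: e).
  by rewrite scalerA invrN mulNr mulVf ?lt_eqF// scaleN1r.
by apply: cone_scale => //; rewrite invr_ge0; lra.
Qed.

(** * Least values of states and one-step enlargement of a cone *)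

Definition lower_value C e v := sup [set t : R | C (v - t *: e)].

Section LowerValue.
Variables (C : V -> Prop) (e v : V).
Hypotheses (cC : convex_cone C) (uC : order_unit C e) (NC : ~ C (- e)).
Let t := lower_value C e v.

Lemma has_lower_value : has_sup [set t : R | C (v - t *: e)].
Proof.
have [Ce Cu] := uC; split.
  have [k hk] := Cu (- v); rewrite opprK in hk.
  by exists (- k); rewrite /= scaleNr opprK addrC.
have [k hk] := Cu v; exists k => s /= hs.
rewrite -subr_ge0; apply: (proper_cone_unit cC NC).
have -> : (k - s) *: e = (k *: e - v) + (v - s *: e).
  by rewrite addrA subrK scalerBl.
exact: cone_add.
Qed.

Lemma le_lower_value s : C (v - s *: e) -> s <= t.
Proof. by move=> h; apply: sup_upper_bound => //; exact: has_lower_value. Qed.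

Lemma lower_value_approx d : 0 < d -> C (v - (t - d) *: e).
Proof.
move=> d0; have [s hs ts] := sup_adherent d0 has_lower_value.
have -> : v - (t - d) *: e = (v - s *: e) + (s - (t - d)) *: e.
  by rewrite [(s - _) *: e]scalerBl addrA subrK.
apply: cone_add => //; apply: cone_scale => //; last by case: uC.
by rewrite subr_ge0 ltW.
Qed.

Definition add_line (w : V) : V -> Prop := fun u => exists s : R, C (u - s *: w).

Lemma add_line_cone w : convex_cone (add_line w).
Proof.
split=> [u u' [s hs] [s' hs']|k u k0 [s hs]].
  exists (s + s'); rewrite scalerDl opprD addrACA; exact: cone_add.
by exists (k * s); rewrite -scalerA -scalerBr; exact: cone_scale.
Qed.

Lemma sub_add_line w u : C u -> add_line w u.
Proof. by exists 0; rewrite scale0r subr0. Qed.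

Lemma add_line_in w s : C 0 -> add_line w (s *: w).
Proof. by move=> C0; exists s; rewrite subrr. Qed.

(** Let [- e - s *: w] be in the cone, with [w = v - t *: e]. If [s > 0], dividing by [s] and adding
    [w + (2 * s)^-1 *: e] puts a negative multiple of [e] in the cone; if [s < 0], dividing by [- s]
    gives a lower bound of [v] above the supremum [t]. *)
Lemma add_lower_value_proper : ~ add_line (v - t *: e) (- e).
Proof.
have [Ce _] := uC; set w := v - t *: e; move=> [s hs].
have [s0|s0|s0] := ltgtP s 0; last first.
- by apply: NC; rewrite s0 scale0r subr0 in hs.
- have s20 : 0 < (2 * s)^-1 by rewrite invr_gt0; lra.
  have := lower_value_approx s20.
  have -> : v - (t - (2 * s)^-1) *: e = w + (2 * s)^-1 *: e.
    by rewrite scalerBl opprB addrA addrAC.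
  move=> /(cone_add cC (cone_scale cC (ltW (_ : 0 < s^-1)) hs)).
  rewrite invr_gt0 => /(_ s0).
  rewrite scalerBr scalerA mulVf ?gt_eqF// scale1r addrA subrK.
  rewrite scalerN -scaleNr -scalerDl => /(proper_cone_unit cC NC).
  have -> : - s^-1 + (2 * s)^-1 = - (2 * s)^-1 by field; lra.
  lra.
have s'0 : 0 < (- s)^-1 by rewrite invr_gt0; lra.
suff /le_lower_value : C (v - (t + (- s)^-1) *: e) by lra.
have -> : v - (t + (- s)^-1) *: e = (- s)^-1 *: (- e - s *: w).
  rewrite scalerBr scalerA mulrC invrN mulrN mulfV ?lt_eqF//.
  rewrite scaleN1r opprK /w scalerDl opprD addrA addrC.
  by rewrite scalerN.
by apply: cone_scale => //; exact: ltW.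
Qed.

End LowerValue.

(** * Construction of a lexicographically minimal state *)

Section PureState.
Variables (M : V -> Prop) (e : V) (b : nat -> V).
Hypotheses (cM : convex_cone M) (uM : order_unit M e) (NM : ~ M (- e)).
Hypothesis genb : generating b.

(** Adjoining a whole line forces every state of the larger cone to vanish on its direction, that
    is, to take the current least value at [b k']. *)
Fixpoint pure_chain k : V -> Prop :=
  if k is k'.+1
  then add_line (pure_chain k') (b k' - lower_value (pure_chain k') e (b k') *: e)
  else M.

Let t k := lower_value (pure_chain k) e (b k).

Lemma pure_chainP k : [/\ convex_cone (pure_chain k),
  order_unit (pure_chain k) e & ~ pure_chain k (- e)].
Proof.
elim: k => [//|k [cC uC NC]]; split => /=.
- exact: add_line_cone.
- split=> [|v]; first by apply: sub_add_line; case: uC.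
  by have [r hr] := uC.2 v; exists r; exact: sub_add_line.
- exact: add_lower_value_proper.
Qed.

Lemma pure_chain_mono j k u : (j <= k)%N -> pure_chain j u -> pure_chain k u.
Proof.
by move=> /subnK <- h; elim: (k - j)%N => // i ih; exact: sub_add_line.
Qed.

Let Minf u := exists k, pure_chain k u.

Let cMinf : convex_cone Minf.
Proof.
split=> [u v [j hj] [k hk]|r u r0 [j hj]].
  have [cC _ _] := pure_chainP (maxn j k).
  exists (maxn j k); apply: cone_add => //.
    by apply: pure_chain_mono hj; exact: leq_maxl.
  by apply: pure_chain_mono hk; exact: leq_maxr.
have [cC _ _] := pure_chainP j.
by exists j; exact: cone_scale.
Qed.

Let NMinf : ~ Minf (- e).
Proof. by move=> [k]; have [_ _] := pure_chainP k. Qed.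

(** [u] equals [r *: e] modulo the lineality space of [Minf], so [r] is the only value a state of
    [Minf] can take at [u]. *)
Let value_of u r := Minf (u - r *: e) /\ Minf (r *: e - u).

Let value_le u r s : value_of u r -> value_of u s -> r <= s.
Proof.
move=> [h _] [_ h']; rewrite -subr_ge0; apply: (proper_cone_unit cMinf NMinf).
have -> : (s - r) *: e = (s *: e - u) + (u - r *: e).
  by rewrite addrA subrK scalerBl.
exact: cone_add.
Qed.

Let value_uniq u r s : value_of u r -> value_of u s -> r = s.
Proof. by move=> h h'; apply/le_anti; rewrite !(value_le (u := u)). Qed.

Let Minf0 : Minf 0.
Proof.
by exists 0; rewrite -(scale0r e) /=; apply: cone_scale => //; case: uM.
Qed.

Let value_add u v r s : value_of u r -> value_of v s -> value_of (u + v) (r + s).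
Proof.
move=> [h h'] [g g']; split; rewrite scalerDl opprD addrACA; exact: cone_add.
Qed.

Let value_opp u r : value_of u r -> value_of (- u) (- r).
Proof. by move=> [h h']; split; rewrite scaleNr opprK addrC. Qed.

Let value_scale k u r : value_of u r -> value_of (k *: u) (k * r).
Proof.
have pos k' u' r' : 0 <= k' -> value_of u' r' -> value_of (k' *: u') (k' * r').
  by move=> k0 [h h']; split; rewrite -scalerA -scalerBr; exact: cone_scale.
have [k0|/ltW k0] := leP 0 k; first exact: pos.
move=> /value_opp /pos -/(_ (- k)); rewrite oppr_ge0 => /(_ k0).
by rewrite scalerN scaleNr opprK mulrNN.
Qed.

Let value_b k : value_of (b k) (t k).
Proof.
have Ck0 : pure_chain k 0.
  by apply: (@pure_chain_mono 0) => //=;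
     rewrite -(scale0r e); apply: cone_scale => //; case: uM.
split; exists k.+1; have := @add_line_in (pure_chain k) (b k - t k *: e).
  by move=> /(_ 1 Ck0); rewrite scale1r.
by move=> /(_ (-1) Ck0); rewrite scaleN1r opprB.
Qed.

Let value_ex u : exists r, value_of u r.
Proof.
apply: (genb (P := fun u => exists r, value_of u r)) => {u}.
- by exists 0; rewrite /value_of scale0r subrr.
- by move=> u v [r hr] [s hs]; exists (r + s); exact: value_add.
- by move=> k v [r hr]; exists (k * r); exact: value_scale.
- by move=> i; exists (t i).
Qed.

(* Each [t k] is the least value on [b k] of a state extending the previous
   choices: a lexicographically minimal state is extreme. *)
Lemma lex_pure_state : exists2 L : {scalar V}, pure_state M e L &
  L (b 0%N) = lower_value M e (b 0%N).
Proof.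
have [L hL] := choice value_ex.
have LL : GRing.linear_for *%R L.
  move=> k u v; apply: (@value_uniq (k *: u + v)) => //.
  by apply: value_add => //; exact: value_scale.
pose LM := GRing.isLinear.Build R V R _ L LL.
pose Ls : {scalar V} := HB.pack L LM.
have Lpos u : Minf u -> 0 <= L u.
  move=> hu; apply: (proper_cone_unit cMinf NMinf).
  by rewrite -(subrK u (L u *: e)); apply: cone_add => //; case: (hL u).
exists Ls; last by apply: (@value_uniq (b 0%N)) => //; exact: value_b.
have Le : L e = 1.
  by apply: (@value_uniq e) => //; rewrite /value_of scale1r subrr.
split=> //; first by move=> u Mu; apply: Lpos; exists 0%N.
move=> L1 c L1pos L1le u.
(* Domination survives each enlargement: [w0 + d *: e] is in the cone for every [d > 0] and
   [L w0 = 0], so letting [d] tend to 0 squeezes [L1 w0] to 0. *)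
have key k : forall w, pure_chain k w -> 0 <= L1 w <= c * L w.
  elim: k => [w Mw|k ih]; first by rewrite L1pos//= L1le.
  have [cC uC NC] := pure_chainP k.
  set w0 := b k - t k *: e.
  have Lw0 : L w0 = 0.
    apply: (@value_uniq w0) => //; have [h h'] := value_b k.
    by split; rewrite scale0r ?subr0 ?sub0r ?opprB.
  have [_ eC] := andP (ih _ uC.1).
  have L1e : 0 <= L1 e by have /andP[] := ih _ uC.1.
  have bd d : 0 < d -> 0 <= L1 w0 + d * L1 e <= c * L w0 + d * c.
    move=> d0; have := ih _ (lower_value_approx (b k) cC uC NC d0).
    have -> : b k - (lower_value (pure_chain k) e (b k) - d) *: e = d *: e + w0.
      by rewrite scalerBl opprB addrCA.
    by rewrite linearP LL Le /=; lra.
  have L1w0 : L1 w0 = 0.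
    apply/eqP; rewrite eq_le; apply/andP; split; apply/ler_addgt0Pl => d d0.
      have c0 : 0 <= c by move: eC; rewrite Le; lra.
      (* Adding 1 keeps the divisor positive when [c = 0]. *)
      have dc : 0 < d / (1 + c) by rewrite divr_gt0//; lra.
      have /andP[_] := bd _ dc; rewrite Lw0 mulr0 add0r addr0.
      have -> : d / (1 + c) * c = d - d / (1 + c) by field; lra.
      have : 0 <= d / (1 + c) * L1 e by rewrite mulr_ge0// ltW.
      lra.
    have de : 0 < d / (1 + L1 e) by rewrite divr_gt0//; lra.
    have /andP[+ _] := bd _ de.
    have -> : d / (1 + L1 e) * L1 e = d - d / (1 + L1 e) by field; lra.
    by lra.
  move=> w [s /ih]; rewrite -/(t k) -/w0.
  have -> : w - s *: w0 = (- s) *: w0 + w by rewrite scaleNr addrC.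
  by rewrite linearP LL Lw0 L1w0 !mulr0 !add0r.
have keyinf w : Minf w -> 0 <= L1 w by move=> [k /key/andP[]].
have [h h'] := hL u.
have := keyinf _ h; have := keyinf _ h'; rewrite !linearB !linearZ /=.
by move=> ? ?; lra.
Qed.

End PureState.

(** With [f] first in the enumeration, the lexicographic state takes its lower value there. This is
    at most 0, since [f - s *: e] in [M] with [s > 0] would put [f] in [M]. *)
Lemma pure_separation M e (I : countType) (b : I -> V) f :
  convex_cone M -> order_unit M e -> generating b -> ~ M f ->
  exists2 L : {scalar V}, pure_state M e L & L f <= 0.
Proof.
move=> cM uM gb Mf; have [Me Mu] := uM.
have NM : ~ M (- e).
  move=> Ne; apply: Mf; have [k hk] := Mu (- f).
  rewrite opprK in hk; have [k0|/ltW k0] := leP 0 k.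
    have -> : f = k *: (- e) + (k *: e + f).
      by rewrite scalerN addrA addNr add0r.
    by apply: cone_add => //; exact: cone_scale.
  have -> : f = (- k) *: e + (k *: e + f).
    by rewrite scaleNr addrA addNr add0r.
  by apply: cone_add => //; apply: cone_scale => //; rewrite oppr_ge0.
(* Numbers that code no index are sent to the harmless vector 0. *)
pose b' k := if k is k'.+1 then oapp b 0 (unpickle k') else f.
have gb' : generating b'.
  move=> P P0 PD PZ Pb; apply: gb => // i.
  by have := Pb (pickle i).+1; rewrite /= pickleK.
have [L pL Lf] := lex_pure_state cM uM NM gb'; exists L => //.
rewrite Lf /=; apply: ge_sup; first by have [] := has_lower_value f cM uM NM.
move=> s /= hs; rewrite leNgt; apply/negP => s0; apply: Mf.
rewrite -(subrK (s *: e) f); apply: cone_add => //.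
by apply: cone_scale => //; exact: ltW.
Qed.

(* Iterating Cauchy-Schwarz: [a * (r 0 / a) ^+ 2 ^ k <= r k]. *)
Lemma geometric_growth_bound (a C N : R) (r : nat -> R) :
  0 <= a -> 0 < N -> (forall k, 0 <= r k) ->
  (forall k, r k ^+ 2 <= a * r k.+1) ->
  (forall k, r k <= C * N ^+ (2 ^ k)) -> r 0%N <= N * a.
Proof.
move=> a0 N0 r0 rS rC; rewrite leNgt; apply/negP => ltr.
have a_gt0 : 0 < a.
  rewrite lt_neqAle a0 andbT; apply/eqP => a00.
  have := rS 0%N; rewrite -a00 mul0r => r00.
  have : 0 < r 0%N by apply: le_lt_trans ltr; rewrite -a00 mulr0.
  by move/(exprn_gt0 2); lra.
(* If the bound fails then [rho > 1], and [r k / (a * N ^+ (2 ^ k))] grows at least like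
   [rho ^+ (2 ^ k)], whereas the last hypothesis bounds it by [C / a]. *)
pose rho := r 0%N / a / N.
have rho1 : 1 < rho by rewrite /rho ltr_pdivlMr// mul1r ltr_pdivlMr.
have grow k : a * N ^+ (2 ^ k) * rho ^+ (2 ^ k) <= r k.
  rewrite -mulrA -exprMn /rho [N * _]mulrC divfK ?gt_eqF//.
  elim: k => [|k ih]; first by rewrite expr1 mulrC divfK// gt_eqF.
  have h : 0 <= r 0%N / a by rewrite divr_ge0.
  rewrite -(ler_pM2l a_gt0); apply: le_trans (rS k).
  rewrite expnS mulnC exprM mulrA -expr2 -exprMn lerXn2r ?nnegrE//.
  by rewrite mulr_ge0// exprn_ge0.
have bernoulli k : 1 + k%:R * (rho - 1) <= rho ^+ k.
  elim: k => [|k ih]; first by rewrite mul0r addr0 expr0.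
  rewrite exprS -natr1; have k0 : 0 <= k%:R :> R by [].
  have := ler_wpM2l (ltW (lt_trans ltr01 rho1)) ih.
  apply: le_trans; rewrite -subr_ge0.
  have -> : rho * (1 + k%:R * (rho - 1)) - (1 + (k%:R + 1) * (rho - 1)) =
    k%:R * (rho - 1) ^+ 2 by ring.
  by rewrite mulr_ge0// sqr_ge0.
have bd k : a * rho ^+ (2 ^ k) <= C.
  have Nk : 0 < N ^+ (2 ^ k) by rewrite exprn_gt0.
  rewrite -(ler_pM2r Nk) mulrAC; exact: le_trans (grow k) (rC k).
have C0 : 0 <= C / a / (rho - 1).
  have : 0 <= C by apply: le_trans (bd 0%N); rewrite mulr_ge0// exprn_ge0//; lra.
  by move=> C0; rewrite !divr_ge0//; lra.
pose k := Num.bound (C / a / (rho - 1)).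
have := archi_boundP C0; rewrite -/k ltr_pdivrMr ?subr_gt0// => hk.
have : rho ^+ (2 ^ k) <= C / a by rewrite ler_pdivlMr// mulrC.
have := bernoulli (2 ^ k)%N.
have : k%:R * (rho - 1) <= (2 ^ k)%:R * (rho - 1) :> R.
  by rewrite ler_pM2r ?subr_gt0// ler_nat ltnW// ltn_expl.
by move=> ? ?; lra.
Qed.

Lemma discriminant_le (a b c : R) :
  (forall s t : R, 0 <= s ^+ 2 * a + 2 * s * t * b + t ^+ 2 * c) ->
  b ^+ 2 <= a * c.
Proof.
move=> h; have a0 : 0 <= a by have := h 1 0; lra.
have [a00|an0] := eqVneq a 0.
  rewrite a00 mul0r; have [->|bn0] := eqVneq b 0; first by rewrite expr0n.
  (* For [a = 0] the form is affine in [s] at [t = 1]; this [s] makes it equal to -1. *)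
  have := h (- (c + 1) / (2 * b)) 1; rewrite a00 mulr0 add0r.
  have -> : 2 * (- (c + 1) / (2 * b)) * 1 * b + 1 ^+ 2 * c = - 1 by field.
  by rewrite oppr_ge0 ler10.
have := h b (- a).
have -> : b ^+ 2 * a + 2 * b * - a * b + (- a) ^+ 2 * c = a * (a * c - b ^+ 2).
  by ring.
by rewrite pmulr_rge0 ?subr_ge0// lt_neqAle eq_sym an0.
Qed.

Lemma iter_linearZB (phi : {linear V -> V}) j k u v :
  iter j phi (k *: u - v) = k *: iter j phi u - iter j phi v.
Proof. by elim: j => //= j ->; rewrite linearB linearZ. Qed.

(* [L (phi ^ 2 m) <= N * L m] on the cone follows from the mere exponential
   bound on [L (phi ^ (2 * k) m)]; then both [L o phi ^ 2] and
   [L o (1 + phi) ^ 2] are dominated by [L], hence proportional to it. *)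
Lemma pure_state_operator M e (L : {scalar V}) (phi : {linear V -> V}) (N : R) :
  order_unit M e -> pure_state M e L -> 0 < N ->
  (forall j (s t : R) v, M v -> 0 <= s ^+ 2 * L v +
     2 * s * t * L (iter j phi v) + t ^+ 2 * L (iter (j + j) phi v)) ->
  (forall j, L (iter (j + j).+2 phi e) <= N * L (iter (j + j) phi e)) ->
  forall v, L (phi v) = L (phi e) * L v.
Proof.
move=> [Me Mu] [Lpos Le pure] N0 Lsq LN.
have even_ge0 j v : M v -> 0 <= L (iter (j + j) phi v).
  by move=> /(Lsq j 0 1); lra.
have even_bound j : L (iter (j + j) phi e) <= N ^+ j.
  elim: j => [|j ih]; first by rewrite Le.
  rewrite addSn addnS exprS; apply: le_trans (LN j) _.
  by rewrite ler_pM2l.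
have sq_le v : M v -> L (phi (phi v)) <= N * L v.
  move=> Mv; have [C hC] := Mu v.
  (* Cauchy-Schwarz along exponents that double gives the quadratic recursion; [C] comes from
     [C *: e - v] in [M], which transfers the bound at [e] to [v]. *)
  apply: (@geometric_growth_bound _ C N
    (fun k => L (iter (2 ^ k + 2 ^ k) phi v))) => //; first exact: Lpos.
  - by move=> k; exact: even_ge0.
  - move=> k; rewrite expnS mul2n -addnn.
    by apply: discriminant_le => s t; exact: Lsq.
  - move=> k; have := even_ge0 (2 ^ k)%N _ hC.
    rewrite iter_linearZB linearB linearZ /= subr_ge0 => /le_trans; apply.
    apply: ler_wpM2l (even_bound _).
    have := even_ge0 0%N _ hC; rewrite /= linearB linearZ /= Le mulr1.
    by have := Lpos _ Mv; lra.
pose L2 : {scalar V} := L \o (phi \o phi).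
have L2pos : positive M L2 by move=> v /(even_ge0 1%N).
have L2E v : L (phi (phi v)) = L (phi (phi e)) * L v.
  by apply: (pure L2 N) => // {}v; exact: sq_le.
pose L1 : {scalar V} := L \o ((idfun \+ phi) \o (idfun \+ phi)).
have L1pos : positive M L1.
  move=> v /(Lsq 1%N 1 1); rewrite /= !linearD /=; lra.
have L1E v : L1 v = L1 e * L v.
  (* Parallelogram identity: adding the nonnegative value of [(1 - phi) ^ 2] cancels the cross
     term. *)
  apply: (pure L1 (2 + 2 * L (phi (phi e)))) => // {}v Mv.
  have := Lsq 1%N 1 (-1) _ Mv; rewrite /= !linearD /= L2E; lra.
move=> v; have := L1E v.
rewrite /= !linearD /= Le L2E; lra.
Qed.
End OrderUnit.

(** * Positive semidefinite matrices and kernels *)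

Section PsdMatrices.
Variables (R : realType) (p : nat).
Implicit Types (S : 'M[R]_p) (w : 'cV[R]_p).

Lemma trace_rank1 S w : \tr (S *m (w *m w^T)) = (w^T *m S *m w) 0 0.
Proof. by rewrite mulmxA mxtrace_mulC mulmxA trace_mx11. Qed.

Lemma dotE w : (w^T *m w) 0 0 = \sum_i w i 0 ^+ 2.
Proof. by rewrite mxE; apply: eq_bigr => i _; rewrite mxE expr2. Qed.

Lemma dot_eq0 w : (w^T *m w) 0 0 = 0 -> w = 0.
Proof.
have w2 (i : 'I_p) : true -> 0 <= w i 0 ^+ 2 by rewrite sqr_ge0.
rewrite dotE => /(psumr_eq0P w2) w0; apply/matrixP => i j.
by rewrite (ord1 j) mxE; apply/eqP; rewrite -sqrf_eq0 w0.
Qed.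

Lemma dot_gt0 w : w != 0 -> 0 < (w^T *m w) 0 0.
Proof.
move=> w0; rewrite lt_neqAle eq_sym dotE sumr_ge0 ?andbT; last first.
  by move=> i _; rewrite sqr_ge0.
by apply: contra w0 => /eqP; rewrite -dotE => /dot_eq0/eqP.
Qed.

(** Cauchy-Schwarz for the form [S] at [y = S *m w] and [w] bounds the square of [y^T *m y] by 0. *)
Lemma psd_kernel S w : psd S -> (w^T *m S *m w) 0 0 = 0 -> S *m w = 0.
Proof.
move=> [symS Spos] w0; pose y := S *m w.
have yT : y^T = w^T *m S by rewrite trmx_mul symS.
have : ((y^T *m y) 0 0) ^+ 2 <= (y^T *m S *m y) 0 0 * 0.
  apply: discriminant_le => s t; have := Spos (s *: y + t *: w).
  have -> : (s *: y + t *: w)^T *m S *m (s *: y + t *: w) =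
      s ^+ 2 *: (y^T *m S *m y) + (2 * s * t) *: (y^T *m y)
      + t ^+ 2 *: (w^T *m S *m w).
    have -> : (s *: y + t *: w)^T *m S = s *: (y^T *m S) + t *: y^T.
      by rewrite linearD !linearZ /= mulmxDl -!scalemxAl -yT.
    rewrite mulmxDr -!scalemxAr !mulmxDl -!scalemxAl -(mulmxA y^T S w) -/y.
    rewrite [in y^T *m w]yT !scalerDr !scalerA addrA -(addrA (_ *: _)).
    rewrite [t * s]mulrC -scalerDl.
    by congr (_ *: _ + _ *: _ + _ *: _); ring.
  have combE (a b c : R) (A B C : 'M[R]_1) : (a *: A + b *: B + c *: C) 0 0 =
      a * A 0 0 + b * B 0 0 + c * C 0 0 by rewrite !mxE.
  by rewrite combE w0.
rewrite mulr0 => yy; apply: dot_eq0.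
by apply/eqP; rewrite -sqrf_eq0 eq_le yy sqr_ge0.
Qed.

(** The columns of [cokermx S] lie in the kernel of [S], so [T] kills them too, and this
    characterizes inclusion of row spaces. *)
Lemma submx_of_kernel S (T : 'M[R]_p) :
  (forall w, S *m w = 0 -> T *m w = 0) -> (T <= S)%MS.
Proof.
move=> h; rewrite submxE; apply/eqP/matrixP => i j.
have Sj : S *m col j (cokermx S) = 0 by rewrite colE mulmxA mulmx_coker mul0mx.
have := h _ Sj; rewrite colE mulmxA -colE => /matrixP/(_ i 0).
by rewrite [col _ _ _ _]mxE => ->; rewrite !mxE.
Qed.

End PsdMatrices.

(** * The restricted quadratic module as a cone of pairs *)

(* [(A0, A1)] stands for the matrix [A0 + lambda A1], seen over [R]. *)
Definition mxpair (R : realType) n p : Type :=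
  ('M[{mpoly R[n]}]_p * 'M[{mpoly R[n]}]_p)%type.

HB.instance Definition _ (R : realType) n p := GRing.Zmodule.on (mxpair R n p).

Section MxPairModule.
Variables (R : realType) (n p : nat).

Definition mxpair_scale (k : R) (u : mxpair R n p) : mxpair R n p :=
  (k%:MP *: u.1, k%:MP *: u.2).

Fact mxpair_scaleA k l u :
  mxpair_scale k (mxpair_scale l u) = mxpair_scale (k * l) u.
Proof. by rewrite /mxpair_scale /= !scalerA -!mpolyCM. Qed.

Fact mxpair_scale1 : left_id 1 mxpair_scale.
Proof. by case=> A0 A1; rewrite /mxpair_scale /= mpolyC1 !scale1r. Qed.

Fact mxpair_scaleDr : right_distributive mxpair_scale +%R.
Proof. by move=> k u v; rewrite /mxpair_scale /= !scalerDr. Qed.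

Fact mxpair_scaleDl u : {morph mxpair_scale^~ u : k l / k + l}.
Proof. by move=> k l; rewrite /mxpair_scale /= mpolyCD !scalerDl. Qed.

HB.instance Definition _ := GRing.Zmodule_isLmodule.Build R (mxpair R n p)
  mxpair_scaleA mxpair_scale1 mxpair_scaleDr mxpair_scaleDl.

Lemma mxpair_scaleE k (u : mxpair R n p) : k *: u = (k%:MP *: u.1, k%:MP *: u.2).
Proof. by []. Qed.

Lemma mxpair_addE (u v : mxpair R n p) : u + v = (u.1 + v.1, u.2 + v.2).
Proof. by []. Qed.

Lemma mxpair_oppE (u : mxpair R n p) : - u = (- u.1, - u.2).
Proof. by []. Qed.

Definition mxpair_mul (T : 'M[{mpoly R[n]}]_p) (u : mxpair R n p) : mxpair R n p :=
  (T *m u.1, T *m u.2).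

Fact mxpair_mul_linear T : linear (mxpair_mul T).
Proof.
move=> k u v; rewrite mxpair_scaleE mxpair_addE /mxpair_mul /=.
by rewrite !mulmxDr -!scalemxAr.
Qed.

HB.instance Definition _ T := GRing.isLinear.Build R (mxpair R n p)
  (mxpair R n p) _ (mxpair_mul T) (mxpair_mul_linear T).

Definition congr_pair (H : 'M[{mpoly R[n]}]_p) (u : mxpair R n p) : mxpair R n p :=
  (H^T *m u.1 *m H, H^T *m u.2 *m H).

Fact congr_pair_linear H : linear (congr_pair H).
Proof.
have lin (K A B : 'M[{mpoly R[n]}]_p) a :
    K *m (a *: A + B) *m H = a *: (K *m A *m H) + K *m B *m H.
  by rewrite mulmxDr mulmxDl scalemxAl scalemxAr.
by move=> k u v; rewrite /congr_pair; apply: f_equal2; exact: lin.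
Qed.

HB.instance Definition _ H := GRing.isLinear.Build R (mxpair R n p)
  (mxpair R n p) _ (congr_pair H) (congr_pair_linear H).

(** A real basis of the pairs over a countable index type, as [pure_separation] requires. *)
Definition elementary_pair (i : bool * 'I_p * 'I_p * 'X_{1..n}) : mxpair R n p :=
  let: (b, r, c, mon) := i in
  let E := 'X_[mon] *: delta_mx r c in if b then (E, 0) else (0, E).

Lemma elementary_pair_generating : generating elementary_pair.
Proof.
move=> P P0 PD PZ Pb.
have Psum I (s : seq I) (f : I -> mxpair R n p) : (forall i, P (f i)) -> P (\sum_(i <- s) f i).
  by move=> h; apply: big_ind => //.
have PE b r c (f : {mpoly R[n]}) :
    P (if b then (f *: delta_mx r c, 0) else (0, f *: delta_mx r c)).
  rewrite [f]mpolyE.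
  elim/big_ind: _ => [|x y hx hy|mon _].
  - by case: b; rewrite scale0r.
  - have := PD _ _ hx hy; case: b {hx hy}; rewrite scalerDl mxpair_addE /=;
    by rewrite addr0.
  - have := PZ f@_mon _ (Pb (b, r, c, mon)); rewrite mxpair_scaleE /=.
    by case: b; rewrite /= scaler0 scalerA mul_mpolyC.
have PM b (A : 'M[{mpoly R[n]}]_p) : P (if b then (A, 0) else (0, A)).
  rewrite [A]matrix_sum_delta.
  elim/big_ind: _ => [|x y hx hy|r _]; first by case: b.
    by have := PD _ _ hx hy; case: b {hx hy}; rewrite mxpair_addE /= addr0.
  elim/big_ind: _ => [|x y hx hy|c _]; [by case: b| |exact: PE].
  by have := PD _ _ hx hy; case: b {hx hy}; rewrite mxpair_addE /= addr0.
move=> [A0 A1]; have := PD _ _ (PM true A0) (PM false A1).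
by rewrite mxpair_addE /= addr0 add0r.
Qed.

End MxPairModule.

(** * Algebra of matrices affine in lambda *)

Section Pencil.
Variables (R : realType) (n : nat).
Implicit Types p : nat.

Lemma pencilD p (A0 A1 B0 B1 : 'M[{mpoly R[n]}]_p) :
  pencil (A0 + B0) (A1 + B1) = pencil A0 A1 + pencil B0 B1.
Proof. by rewrite /pencil /const_in_lambda !map_mxD scalerDr addrACA. Qed.

Lemma pencilB p (A0 A1 B0 B1 : 'M[{mpoly R[n]}]_p) :
  pencil (A0 - B0) (A1 - B1) = pencil A0 A1 - pencil B0 B1.
Proof. by rewrite /pencil /const_in_lambda !map_mxB scalerBr addrACA opprD. Qed.

Lemma pencilZ p (a : {mpoly R[n]}) (A0 A1 : 'M[{mpoly R[n]}]_p) :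
  pencil (a *: A0) (a *: A1) = a%:P *: pencil A0 A1.
Proof.
by rewrite /pencil /const_in_lambda !map_mxZ scalerDr !scalerA mulrC.
Qed.

Lemma pencil_tr p (A0 A1 : 'M[{mpoly R[n]}]_p) :
  (pencil A0 A1)^T = pencil A0^T A1^T.
Proof. by rewrite /pencil /const_in_lambda linearD linearZ /= !map_trmx. Qed.

Lemma pencil_congr p q (A0 A1 : 'M[{mpoly R[n]}]_q) (H : 'M[{mpoly R[n]}]_(q, p)) :
  (const_in_lambda H)^T *m pencil A0 A1 *m const_in_lambda H =
  pencil (H^T *m A0 *m H) (H^T *m A1 *m H).
Proof.
rewrite /pencil /const_in_lambda mulmxDr mulmxDl -scalemxAr -scalemxAl.
by rewrite map_trmx !map_mxM.
Qed.

Lemma coef_pencil p (A0 A1 : 'M[{mpoly R[n]}]_p) i j :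
  (pencil A0 A1 i j)`_0 = A0 i j /\ (pencil A0 A1 i j)`_1 = A1 i j.
Proof.
by split; rewrite !mxE coefD coefC coefXM coefC /= ?addr0 ?add0r.
Qed.

Lemma pencil_inj p (A0 A1 B0 B1 : 'M[{mpoly R[n]}]_p) :
  pencil A0 A1 = pencil B0 B1 -> A0 = B0 /\ A1 = B1.
Proof.
move=> h; split; apply/matrixP => i j.
  by rewrite -(coef_pencil A0 A1 i j).1 h (coef_pencil B0 B1 i j).1.
by rewrite -(coef_pencil A0 A1 i j).2 h (coef_pencil B0 B1 i j).2.
Qed.

Lemma pencil_sym p (A0 A1 : 'M[{mpoly R[n]}]_p) :
  (pencil A0 A1)^T = pencil A0 A1 -> A0^T = A0 /\ A1^T = A1.
Proof. by rewrite pencil_tr => /pencil_inj. Qed.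

Lemma affine_pencil p (A0 A1 : 'M[{mpoly R[n]}]_p) i j :
  affine_in_lambda (pencil A0 A1 i j).
Proof. by exists (A0 i j), (A1 i j); rewrite !mxE. Qed.

Lemma eval_pencil p x l (A0 A1 : 'M[{mpoly R[n]}]_p) :
  eval_mx x l (pencil A0 A1) =
  map_mx (meval (x 0)) A0 + l *: map_mx (meval (x 0)) A1.
Proof.
apply/matrixP => i j; rewrite !mxE /eval_xl rmorphD rmorphM /=.
by rewrite map_polyX !map_polyC /= hornerD hornerM hornerX !hornerC.
Qed.

End Pencil.

(** * Closure properties of the quadratic module and its order unit *)

Section QuadraticModule.
Variables (R : realType) (n m : nat) (q : 'I_m -> nat).
Variable G : forall i, 'M[xlpoly R n]_(q i).

Lemma restricted_qmD p (S T : 'M[xlpoly R n]_p) :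
  restricted_qm G S -> restricted_qm G T -> restricted_qm G (S + T).
Proof.
move=> [S0 [k [H [[a [P ->]] ->]]]] [T0 [l [K [[b [Q ->]] ->]]]].
exists (P^T *m P + Q^T *m Q), (fun i => (k i + l i)%N),
  (fun i nu => match split nu with inl x => H i x | inr y => K i y end).
split; first by exists (a + b)%N, (col_mx P Q); rewrite tr_col_mx mul_row_col.
rewrite addrACA [const_in_lambda (_ + _)]map_mxD.
congr (_ + _); rewrite -big_split.
apply: eq_bigr => i _; rewrite big_split_ord.
apply: f_equal2; apply: eq_bigr => nu _.
- by have -> : split (lshift (l i) nu) = inl nu by exact: (unsplitK (inl nu)).
- by have -> : split (rshift (k i) nu) = inr nu by exact: (unsplitK (inr nu)).
Qed.

Lemma restricted_qm_congr p s (T : 'M[xlpoly R n]_p) (K : 'M[{mpoly R[n]}]_(p, s)) :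
  restricted_qm G T ->
  restricted_qm G ((const_in_lambda K)^T *m T *m const_in_lambda K).
Proof.
move=> [S0 [k [H [[a [P ->]] ->]]]].
exists ((P *m K)^T *m (P *m K)), k, (fun i nu => H i nu *m K).
split; first by exists a, (P *m K).
rewrite mulmxDr mulmxDl; congr (_ + _).
  by rewrite /const_in_lambda map_trmx -!map_mxM trmx_mul !mulmxA.
rewrite mulmx_sumr mulmx_suml; apply: eq_bigr => i _.
rewrite mulmx_sumr mulmx_suml; apply: eq_bigr => nu _.
by rewrite /const_in_lambda map_mxM trmx_mul !mulmxA.
Qed.

(** Scaling by [c] is congruence by the scalar matrix of [Num.sqrt c]. *)
Lemma restricted_qm_scale p (c : R) (T : 'M[xlpoly R n]_p) : 0 <= c ->
  restricted_qm G T -> restricted_qm G (c%:MP%:P *: T).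
Proof.
move=> c0 /(restricted_qm_congr (Num.sqrt c)%:MP%:M).
rewrite /const_in_lambda map_scalar_mx tr_scalar_mx.
rewrite mul_scalar_mx mul_mx_scalar scalerA -rmorphM -mpolyCM.
by rewrite -expr2 sqr_sqrtr.
Qed.

Lemma restricted_qm_sos p (S : 'M[{mpoly R[n]}]_p) :
  sos_mx S -> restricted_qm G (const_in_lambda S).
Proof.
move=> sS; exists S, (fun=> 0%N), (fun i _ => 0); split=> //.
by rewrite big1 ?addr0// => i _; rewrite big_ord0.
Qed.

Lemma restricted_qm_gen p i (H : 'M[{mpoly R[n]}]_(q i, p)) :
  restricted_qm G ((const_in_lambda H)^T *m G i *m const_in_lambda H).
Proof.
exists 0, (fun=> 1%N), (fun j _ => dfwith (fun j => 0 : 'M_(q j, p)) H j).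
split; first by exists 0%N, 0; rewrite mulmx0.
rewrite /const_in_lambda map_mx0 add0r (bigD1 i)//= big_ord1 dfwith_in.
rewrite big1 ?addr0// => j ji; rewrite big_ord1 dfwith_out 1?eq_sym//.
by rewrite map_mx0 mulmx0.
Qed.

(** Symmetrizing extends the cone to all pairs, a space stable under one-sided multiplication; skew
    pairs fall into its lineality space. *)
Definition sym_qm p (u : mxpair R n p) : Prop :=
  restricted_qm G (pencil (u.1 + u.1^T) (u.2 + u.2^T)).

Lemma sym_qm_cone p : convex_cone (@sym_qm p).
Proof.
split=> [u v|k u k0] h; rewrite /sym_qm.
  move=> h'; rewrite mxpair_addE /= !linearD /= addrACA [_.2 + _ + _]addrACA.
  by rewrite pencilD; apply: restricted_qmD h h'.
rewrite mxpair_scaleE /= !linearZ /= -!scalerDr pencilZ.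
exact: restricted_qm_scale k0 h.
Qed.

Lemma sym_qm_congr p (K : 'M[{mpoly R[n]}]_p) u :
  sym_qm u -> sym_qm (congr_pair K u).
Proof.
have sE A : K^T *m A *m K + (K^T *m A *m K)^T = K^T *m (A + A^T) *m K.
  by rewrite trmx_mul trmx_mul trmxK mulmxA mulmxDr mulmxDl.
by move=> /(restricted_qm_congr K); rewrite pencil_congr -!sE.
Qed.

Lemma sym_qm_sym p (A0 A1 : 'M[{mpoly R[n]}]_p) : A0^T = A0 -> A1^T = A1 ->
  (sym_qm (A0, A1) <-> restricted_qm G (pencil A0 A1)).
Proof.
move=> s0 s1; rewrite /sym_qm /= s0 s1.
have twice (A : 'M[{mpoly R[n]}]_p) : A + A = 2%:MP *: A.
  by rewrite mpolyC_nat scaler_nat mulr2n.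
rewrite !twice pencilZ.
split=> h; last exact: restricted_qm_scale.
have := @restricted_qm_scale p 2^-1 _ _ h.
rewrite scalerA -rmorphM -mpolyCM mulVf ?pnatr_eq0// mpolyC1 scale1r.
by apply; rewrite invr_ge0.
Qed.

Lemma sym_qm_skew p (A0 A1 : 'M[{mpoly R[n]}]_p) :
  A0^T = - A0 -> A1^T = - A1 -> sym_qm (A0, A1).
Proof.
move=> s0 s1; rewrite /sym_qm /= s0 s1 !subrr.
have -> : pencil 0 0 = const_in_lambda 0 :> 'M[xlpoly R n]_p.
  by rewrite /pencil /const_in_lambda map_mx0 scaler0 addr0.
by apply: restricted_qm_sos; exists 0%N, 0; rewrite mulmx0.
Qed.

Lemma sym_qm_sos p (S : 'M[{mpoly R[n]}]_p) : sos_mx S -> sym_qm (S, 0).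
Proof.
move=> sS; have symS : S^T = S by case: sS => k [P ->]; rewrite trmx_mul trmxK.
apply/sym_qm_sym; rewrite ?trmx0//.
have -> : pencil S 0 = const_in_lambda S.
  by rewrite /pencil /const_in_lambda map_mx0 scaler0 addr0.
exact: restricted_qm_sos.
Qed.

Lemma sym_qm_unit p : restricted_archimedean G p ->
  order_unit (@sym_qm p) (1%:M, 0).
Proof.
move=> arch; split.
  by apply: sym_qm_sos; exists p, 1%:M; rewrite mulmx1 trmx1.
move=> [A0 A1]; have [|N [_ [_ h]]] := arch (pencil (A0 + A0^T) (A1 + A1^T)).
  split; last by move=> i j; exact: affine_pencil.
  by rewrite pencil_tr !linearD /= !trmxK addrC [A1 + _]addrC.
(* Half of [N], because symmetrization doubles the identity. *)
exists (N / 2); rewrite /sym_qm mxpair_scaleE mxpair_oppE mxpair_addE /=.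
rewrite scaler0 sub0r !linearD !linearN /= linearZ /= trmx1.
rewrite addrACA -scalerDl -mpolyCD -splitr -!opprD.
move: h; congr (restricted_qm _ _).
rewrite -[- (A1 + _)]add0r pencilB; congr (_ - _).
rewrite /pencil /const_in_lambda map_mx0 scaler0 addr0.
by rewrite scalemx1 map_scalar_mx.
Qed.

End QuadraticModule.

(** * Pure states of the restricted quadratic module *)

Section PureStateOfPencils.
Variables (R : realType) (n m p : nat) (q : 'I_m -> nat).
Variable G : forall i, 'M[xlpoly R n]_(q i).
Let e : mxpair R n p := (1%:M, 0).
Variable L : {scalar mxpair R n p}.
Hypotheses (arch : restricted_archimedean G p)
  (pureL : pure_state (sym_qm G (p := p)) e L).

Let Lpos u : sym_qm G u -> 0 <= L u.
Proof. by case: pureL => + _ _; apply. Qed.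

(** Symmetry of left multiplication by [X] for the state: under [L] the congruence of [u] by [X^T]
    becomes two left multiplications by [X], so their composite is nonnegative on the cone. *)
Definition selfadjoint_mul (X : 'M[{mpoly R[n]}]_p) :=
  forall u, L (mxpair_mul X u) = L (u.1 *m X^T, u.2 *m X^T).

Lemma selfadjoint_congr X u : selfadjoint_mul X ->
  L (congr_pair X^T u) = L (mxpair_mul X (mxpair_mul X u)).
Proof. by move=> ->; rewrite /congr_pair trmxK. Qed.

Lemma mxpair_mulM X Y (u : mxpair R n p) :
  mxpair_mul (X *m Y) u = mxpair_mul X (mxpair_mul Y u).
Proof. by rewrite /mxpair_mul /=; apply: f_equal2; rewrite -mulmxA. Qed.

Lemma mxpair_mul1 (u : mxpair R n p) : mxpair_mul 1%:M u = u.
Proof. by case: u => A0 A1; rewrite /mxpair_mul /= mul1mx mul1mx. Qed.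

Lemma selfadjoint_exp T j : selfadjoint_mul T -> selfadjoint_mul (T ^+ j).
Proof.
move=> sT; elim: j => [|j ih] u.
  rewrite expr0 -[1]/(1%:M) trmx1 mxpair_mul1 mulmx1 mulmx1.
  by case: u.
have -> : (T ^+ j.+1)^T = T^T *m (T ^+ j)^T by rewrite exprSr trmx_mul.
rewrite exprS -[_ * _]/(T *m _) mxpair_mulM sT.
have := ih (u.1 *m T^T, u.2 *m T^T); rewrite /mxpair_mul /=.
rewrite (mulmxA (T ^+ j) u.1 T^T) (mulmxA (T ^+ j) u.2 T^T) => ->.
by rewrite -(mulmxA u.1 T^T) -(mulmxA u.2 T^T).
Qed.

Lemma iter_mxpair_mul T j (u : mxpair R n p) :
  iter j (mxpair_mul T) u = mxpair_mul (T ^+ j) u.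
Proof.
elim: j => [|j /= ->]; first by rewrite expr0 -[1]/(1%:M) mxpair_mul1.
by rewrite exprS -[T * _]/(T *m _) mxpair_mulM.
Qed.

(** An instance of [pure_state_operator]: congruences by [s + t T ^+ j] give the quadratic forms,
    and conjugating the order unit bound on [T *m T^T] by powers of [T] gives the growth bound. *)
Lemma selfadjoint_scalar T u : selfadjoint_mul T ->
  L (mxpair_mul T u) = L (mxpair_mul T e) * L u.
Proof.
move=> sT; have ou := sym_qm_unit arch.
have [k hk] := ou.2 (T *m T^T, 0).
have sq j (s t : R) v : sym_qm G v -> 0 <= s ^+ 2 * L v +
    2 * s * t * L (iter j (mxpair_mul T) v) +
    t ^+ 2 * L (iter (j + j) (mxpair_mul T) v).
  move=> Mv; pose X := s%:MP%:M + t%:MP *: T ^+ j.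
  have XE w : mxpair_mul X w = s *: w + t *: mxpair_mul (T ^+ j) w.
    have E (A : 'M_p) : X *m A = s%:MP *: A + t%:MP *: (T ^+ j *m A).
      by rewrite mulmxDl mul_scalar_mx -scalemxAl.
    by rewrite mxpair_scaleE mxpair_scaleE mxpair_addE /mxpair_mul !E.
  have sX : selfadjoint_mul X.
    move=> w; rewrite XE linearD !linearZ /= selfadjoint_exp//.
    rewrite -!linearZ -linearD; congr (L _).
    have E (A : 'M_p) : A *m X^T = s%:MP *: A + t%:MP *: (A *m (T ^+ j)^T).
      by rewrite linearD linearZ /= tr_scalar_mx mulmxDr mul_mx_scalar -scalemxAr.
    by rewrite mxpair_scaleE mxpair_scaleE mxpair_addE !E.
  have := Lpos (sym_qm_congr X^T Mv).
  rewrite selfadjoint_congr// XE XE linearD !linearZ /= !linearD !linearZ /=.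
  by rewrite -!iter_mxpair_mul -iterD; lra.
apply: (pure_state_operator (N := Num.max k 1) ou pureL _ sq) => [|j].
  by rewrite lt_max ltr01 orbT.
have Lj : 0 <= L (iter (j + j) (mxpair_mul T) e).
  by have := sq j 0 1 _ ou.1; lra.
have kN : k <= Num.max k 1 by rewrite le_max lexx.
apply: le_trans (ler_wpM2r Lj kN).
have Ej l : L (iter (l + l) (mxpair_mul T) e) = L (congr_pair (T ^+ l)^T e).
  rewrite selfadjoint_congr; last exact: selfadjoint_exp.
  by rewrite -!iter_mxpair_mul -iterD.
have ETT : congr_pair (T ^+ j)^T (T *m T^T, 0) = congr_pair (T ^+ j.+1)^T e.
  rewrite /congr_pair /= mulmx0 mulmx0 mul0mx mul0mx !trmxK mulmx1.
  apply: f_equal2 => //; rewrite exprSr -[_ * T]/(_ *m T) trmx_mul.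
  by rewrite (mulmxA (T ^+ j) T) (mulmxA (T ^+ j *m T)).
have h : L (congr_pair (T ^+ j)^T (T *m T^T, 0)) <= k * L (congr_pair (T ^+ j)^T e).
  have := Lpos (sym_qm_congr (T ^+ j)^T hk).
  by rewrite linearB linearZ /= linearB linearZ /= subr_ge0.
have Ej1 := Ej j.+1; rewrite addSn addnS in Ej1.
have le_of_eq (a b : R) : a = b -> a <= b by move=> ->.
refine (le_trans (le_of_eq _ _ (etrans Ej1 (congr1 L (esym ETT)))) _).
exact: le_trans h (le_of_eq _ _ (congr1 ( *%R k) (esym (Ej j)))).
Qed.

(** * The point x and the moment matrices *)

Definition coord_functional (a : {mpoly R[n]}) := L (a%:M, 0).

Lemma state_mul a u : L (mxpair_mul a%:M u) = coord_functional a * L u.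
Proof.
rewrite selfadjoint_scalar /coord_functional; last first.
  by move=> w; rewrite tr_scalar_mx /mxpair_mul !mul_scalar_mx !mul_mx_scalar.
by rewrite /mxpair_mul /= mulmx1 mulmx0.
Qed.

Definition point : 'rV[R]_n := \row_j coord_functional 'X_j.

(** By [state_mul] the functional is multiplicative, hence an algebra homomorphism to the reals,
    determined by the images of the variables. *)
Lemma coord_functionalE a : coord_functional a = a.@[point 0].
Proof.
pose chi := coord_functional.
have chiM a' b : chi (a' * b) = chi a' * chi b.
  rewrite /chi -state_mul; congr (L _).
  by rewrite /mxpair_mul /= mulmx0 -scalar_mxM.
have chi1 : chi 1 = 1 by case: pureL.
have chiD a' b : chi (a' + b) = chi a' + chi b.
  rewrite /chi /coord_functional -linearD; congr (L _).
  by rewrite mxpair_addE /= raddfD addr0.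
have chiZ c b : chi (c *: b) = c * chi b.
  rewrite /chi /coord_functional -linearZ; congr (L _).
  by rewrite mxpair_scaleE /= scaler0 scale_scalar_mx mul_mpolyC.
have chi0 : chi 0 = 0 by rewrite -(scale0r 0) chiZ mul0r.
have chiX b k : chi (b ^+ k) = chi b ^+ k.
  by elim: k => [|k ih]; rewrite ?expr0// !exprS chiM ih.
rewrite -/(chi a) mevalE [in LHS](mpolyE a).
rewrite (big_morph chi chiD chi0); apply: eq_bigr => mon _.
rewrite chiZ mpolyXE_id (big_morph chi chiM chi1); congr (_ * _).
by apply: eq_bigr => i _; rewrite chiX mxE.
Qed.

(** The indices are transposed so that the matrix represents [L] through the trace pairing. *)
Definition moment0 : 'M[R]_p := \matrix_(i, j) L (delta_mx j i, 0).
Definition moment1 : 'M[R]_p := \matrix_(i, j) L (0, delta_mx j i).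

Let ev r : 'M_r -> 'M[R]_r := map_mx (meval (point 0)).

Lemma state_trace u :
  L u = \tr (moment0 *m ev u.1) + \tr (moment1 *m ev u.2).
Proof.
have trE (S : 'M[R]_p) (A : 'M[{mpoly R[n]}]_p) :
    \tr (S *m ev A) = \sum_i \sum_j (A i j).@[point 0] * S j i.
  rewrite exchange_big; apply: eq_bigr => i _; rewrite mxE.
  by apply: eq_bigr => j _; rewrite mxE mulrC.
case: u => A0 A1 /=; rewrite !trE.
have -> : (A0, A1) = ((A0, 0) : mxpair R n p) + (0, A1).
  by rewrite mxpair_addE /= addr0 add0r.
rewrite linearD; apply: f_equal2.
  rewrite [in LHS](matrix_sum_delta A0).
  have h (F : 'I_p -> 'M[{mpoly R[n]}]_p) :
      L (\sum_i F i, 0) = \sum_i L (F i, 0).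
    apply: (big_morph (fun A => L (A, 0))) => [x y|]; last exact: linear0.
    by rewrite -linearD mxpair_addE /= addr0.
  rewrite h; apply: eq_bigr => i _; rewrite h; apply: eq_bigr => j _.
  rewrite mxE -coord_functionalE -state_mul; congr (L _).
  by rewrite /mxpair_mul /= mulmx0 mul_scalar_mx.
rewrite [in LHS](matrix_sum_delta A1).
have h (F : 'I_p -> 'M[{mpoly R[n]}]_p) :
    L (0, \sum_i F i) = \sum_i L (0, F i).
  apply: (big_morph (fun A => L (0, A))) => [x y|]; last exact: linear0.
  by rewrite -linearD mxpair_addE /= addr0.
rewrite h; apply: eq_bigr => i _; rewrite h; apply: eq_bigr => j _.
rewrite mxE -coord_functionalE -state_mul; congr (L _).
by rewrite /mxpair_mul /= mulmx0 mul_scalar_mx.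
Qed.

Lemma state_skew A0 A1 : A0^T = - A0 -> A1^T = - A1 -> L (A0, A1) = 0.
Proof.
move=> s0 s1; apply/le_anti; rewrite Lpos ?andbT; last exact: sym_qm_skew.
rewrite -oppr_ge0 -linearN Lpos// mxpair_oppE; apply: sym_qm_skew => /=;
by rewrite linearN /= ?s0 ?s1.
Qed.

Lemma moment_sym : moment0^T = moment0 /\ moment1^T = moment1.
Proof.
split; apply/matrixP => i j; rewrite !mxE; apply/eqP; rewrite -subr_eq0;
  rewrite -linearB mxpair_oppE mxpair_addE /= subrr state_skew//.
all: by rewrite ?trmx0 ?oppr0// linearB /= !trmx_delta opprB.
Qed.

Let cst r s (A : 'M[R]_(r, s)) : 'M[{mpoly R[n]}]_(r, s) := map_mx (@mpolyC n R) A.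

Let evM r s t (A : 'M[{mpoly R[n]}]_(r, s)) (B : 'M_(s, t)) :
  map_mx (meval (point 0)) (A *m B) =
  map_mx (meval (point 0)) A *m map_mx (meval (point 0)) B.
Proof. exact: map_mxM. Qed.

Let ev_cst r s (A : 'M[R]_(r, s)) : map_mx (meval (point 0)) (cst A) = A.
Proof. by apply/matrixP => i j; rewrite !mxE mevalC. Qed.

(** The trace of [moment0] is [L e = 1]. *)
Lemma moment0_diag : exists i, 0 < moment0 i i.
Proof.
have Le : L e = 1 by case: pureL.
have : 0 < \tr moment0.
  suff <- : L e = \tr moment0 by rewrite Le.
  rewrite state_trace /= /ev map_mx0 mulmx0 linear0 addr0 map_scalar_mx rmorph1.
  by rewrite mulmx1.
have [i0 hi0|no] := pickP (fun i => 0 < moment0 i i); first by exists i0.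
rewrite ltNge => /negP[]; apply: sumr_le0 => i _.
by rewrite leNgt no.
Qed.

(** Congruence by a rank one constant turns [A] into [w *m w^T] times the scalar [d^T *m A *m d].
    The size [r] is free, so the [G i] can be tested as well. *)
Lemma state_congr_rank1 r (d : 'cV[R]_r) (w : 'cV[R]_p) (A0 A1 : 'M[{mpoly R[n]}]_r) :
  let H := cst (d *m w^T) in
  L (H^T *m A0 *m H, H^T *m A1 *m H) =
  (d^T *m ev A0 *m d) 0 0 * (w^T *m moment0 *m w) 0 0 +
  (d^T *m ev A1 *m d) 0 0 * (w^T *m moment1 *m w) 0 0.
Proof.
move=> H; have E (S : 'M[R]_p) A :
    \tr (S *m ev (H^T *m A *m H)) =
    (d^T *m ev A *m d) 0 0 * (w^T *m S *m w) 0 0.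
  rewrite /ev !evM -map_trmx ev_cst -/(ev A) trmx_mul trmxK.
  rewrite -[w *m d^T *m _ *m _]mulmxA -[w *m d^T *m _]mulmxA.
  rewrite [d^T *m (ev A *m _)]mulmxA.
  rewrite [d^T *m _ *m (d *m _)]mulmxA [in LHS](mx11_scalar (_ *m d)).
  rewrite mul_scalar_mx.
  by rewrite -!scalemxAr linearZ /= trace_rank1.
by rewrite state_trace; apply: f_equal2; exact: E.
Qed.

(** The order unit dominates [b] times lambda, so [c *: moment0 - b *: moment1] is positive
    semidefinite for some [c]. Taking [b] to be 1 and -1 makes the form of [moment1] vanish at [w],
    and [psd_kernel] applies. *)
Lemma moment_kernel (w : 'cV[R]_p) : moment0 *m w = 0 -> moment1 *m w = 0.
Proof.
move=> w0; have [Mu Mk] := sym_qm_unit arch.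
have [sym0 sym1] := moment_sym.
(* Only the existence of an index matters here: [d] is any unit vector. *)
have [i0 _] := moment0_diag; pose d : 'cV[R]_p := delta_mx i0 0.
have dcd (a : R) : (d^T *m ev a%:MP%:M *m d) 0 0 = a.
  rewrite /ev map_scalar_mx /= mevalC mul_mx_scalar -scalemxAl /d trmx_delta.
  by rewrite mul_delta_mx !mxE !eqxx mulr1.
have quadE (c b : R) (v : 'cV[R]_p) :
    (v^T *m (c *: moment0 - b *: moment1) *m v) 0 0 =
    c * (v^T *m moment0 *m v) 0 0 - b * (v^T *m moment1 *m v) 0 0.
  rewrite mulmxBr mulmxBl -!scalemxAr -!scalemxAl [LHS]mxE [X in _ + X]mxE.
  by congr (_ - _); rewrite [LHS]mxE.
have psdb b : exists c, psd (c *: moment0 - b *: moment1).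
  have [c hc] := Mk (0, b%:MP%:M); exists c.
  split=> [|v]; first by rewrite linearB !linearZ /= sym0 sym1.
  have := Lpos (sym_qm_congr (cst (d *m v^T)) hc).
  rewrite mxpair_scaleE mxpair_oppE mxpair_addE /congr_pair state_congr_rank1 /=.
  rewrite subr0 scaler0 add0r scalemx1 -raddfN -mpolyCN !dcd.
  by rewrite quadE mulNr.
have w00 : (w^T *m moment0 *m w) 0 0 = 0 by rewrite -mulmxA w0 mulmx0 mxE.
have [c1 psd1] := psdb 1; have [c2 psd2] := psdb (-1).
have w10 : (w^T *m moment1 *m w) 0 0 = 0.
  have := psd1.2 w; have := psd2.2 w; rewrite !quadE w00; lra.
have := psd_kernel psd1 (w := w); rewrite quadE w00 w10 !mulr0 subrr => /(_ erefl).
by rewrite mulmxBl -!scalemxAl w0 scaler0 sub0r scale1r => /eqP; rewrite oppr_eq0 => /eqP.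
Qed.

(** Kernel inclusion gives [moment1 = moment0 *m T] with [T] the transpose of [D], so [T] plays the
    role of lambda. Symmetry of [moment1] makes [T] symmetric for the state, hence a scalar by
    purity. *)
Lemma moment_proportional : exists mu, moment1 = mu *: moment0.
Proof.
have [sym0 sym1] := moment_sym.
have /submxP[D SD] := submx_of_kernel moment_kernel.
have S1T : moment0 *m D^T = moment1 by rewrite -sym1 SD trmx_mul sym0.
have TS1 : D *m moment1 = moment1 *m D^T by rewrite [in RHS]SD -mulmxA S1T.
have sT : selfadjoint_mul (cst D^T).
  move=> u; rewrite !state_trace /= /ev !evM -map_trmx !ev_cst -/(ev u.1) -/(ev u.2).
  rewrite trmxK !mulmxA S1T -TS1.
  rewrite [\tr (_ *m _ *m D)]mxtrace_mulC [\tr (moment1 *m _ *m D)]mxtrace_mulC.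
  by rewrite !mulmxA -SD.
exists (L (mxpair_mul (cst D^T) e)); apply/matrixP => i j; rewrite !mxE.
rewrite -selfadjoint_scalar// !state_trace /= /ev map_mx0 mulmx0 linear0 add0r.
by rewrite mulmx0 map_mx0 mulmx0 linear0 addr0 evM ev_cst mulmxA S1T map_delta_mx.
Qed.

Lemma state_trace_at mu u : moment1 = mu *: moment0 ->
  L u = \tr (moment0 *m (ev u.1 + mu *: ev u.2)).
Proof.
by move=> S1; rewrite state_trace S1 mulmxDr linearD -scalemxAl -scalemxAr.
Qed.

(** On the congruence of [G i] by [w *m d^T], a member of the cone, the state is the form of [G i]
    at [w] times the positive number [moment0 i0 i0]. *)
Lemma localizing_psd mu i (B0 B1 : 'M[{mpoly R[n]}]_(q i)) :
  moment1 = mu *: moment0 -> B0^T = B0 -> B1^T = B1 -> G i = pencil B0 B1 ->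
  psd (eval_mx point mu (G i)).
Proof.
move=> S1 sB0 sB1 GE; rewrite GE eval_pencil; split=> [|w].
  by rewrite linearD linearZ /= !map_trmx sB0 sB1.
have [i0 s0] := moment0_diag; pose d : 'cV[R]_p := delta_mx i0 0.
have ds : (d^T *m moment0 *m d) 0 0 = moment0 i0 i0.
  by rewrite /d trmx_delta -rowE -colE [LHS]mxE [LHS]mxE.
pose H := cst (w *m d^T).
have : sym_qm G (H^T *m B0 *m H, H^T *m B1 *m H).
  apply/sym_qm_sym; last by rewrite -pencil_congr -GE; exact: restricted_qm_gen.
    by rewrite !trmx_mul trmxK sB0 mulmxA.
  by rewrite !trmx_mul trmxK sB1 mulmxA.
move=> /Lpos; rewrite state_congr_rank1 S1 -!scalemxAr -!scalemxAl.
have combE (A B : 'M[R]_1) : (A + mu *: B) 0 0 = A 0 0 + mu * B 0 0.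
  by rewrite !mxE.
have scaleE (A : 'M[R]_1) : (mu *: A) 0 0 = mu * A 0 0 by rewrite mxE.
rewrite scaleE ds mulrA -mulrDl pmulr_lge0//.
by rewrite mulmxDr mulmxDl -scalemxAr -scalemxAl combE [_ * mu]mulrC.
Qed.

(* The rank one part [S0 d d^T S0 / (d^T S0 d)] of [S0] is a congruence of [S0]
   and so is its complement, so purity makes the state a vector state. *)
Lemma pure_state_is_vector_state : exists (mu : R) (v : 'cV[R]_p) (c : R),
  [/\ v != 0, 0 < c, moment1 = mu *: moment0 &
    forall u, c * L u = (v^T *m (ev u.1 + mu *: ev u.2) *m v) 0 0].
Proof.
have [mu S1] := moment_proportional; have [sym0 _] := moment_sym.
have [i0 s0] := moment0_diag; set s := moment0 i0 i0 in s0.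
pose d : 'cV[R]_p := delta_mx i0 0; pose v := moment0 *m d.
have ds : d^T *m moment0 *m d = s%:M.
  rewrite [LHS]mx11_scalar; congr (_%:M).
  by rewrite /d trmx_delta -rowE -colE [LHS]mxE [LHS]mxE.
have vT : v^T = d^T *m moment0 by rewrite trmx_mul sym0.
have v0 : v != 0.
  apply: contraTneq s0 => v0; have := ds; rewrite -mulmxA -/v v0 mulmx0.
  by move=> /matrixP/(_ 0 0); rewrite !mxE eqxx mulr1n => <-; rewrite ltxx.
(* [H] is idempotent and [H *m moment0] is symmetric, so the congruences of [moment0] by [H] and
   [1%:M - H] add up to [moment0] without cross terms. *)
pose H := s^-1 *: (v *m d^T).
have HS : H *m moment0 = s^-1 *: (v *m v^T).
  by rewrite -scalemxAl -mulmxA -vT.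
have HT : H^T = s^-1 *: (d *m v^T) by rewrite linearZ /= trmx_mul trmxK.
have SH : moment0 *m H^T = s^-1 *: (v *m v^T).
  by rewrite HT -scalemxAr mulmxA.
have HSH : H *m moment0 *m H^T = s^-1 *: (v *m v^T).
  have Hv : H *m (v *m v^T) = v *m v^T.
    have dv : d^T *m v = s%:M by rewrite mulmxA.
    rewrite -scalemxAl -mulmxA (mulmxA d^T) dv mul_scalar_mx -scalemxAr scalerA.
    by rewrite mulVf ?scale1r// gt_eqF.
  by rewrite -mulmxA SH -scalemxAr Hv.
have congrE (K : 'M[R]_p) u : L (congr_pair (cst K) u) =
    \tr (K *m moment0 *m K^T *m (ev u.1 + mu *: ev u.2)).
  rewrite (state_trace_at _ S1) /ev !evM -map_trmx ev_cst -/(ev u.1) -/(ev u.2).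
  rewrite scalemxAl scalemxAr -mulmxDl -mulmxDr mulmxA mxtrace_mulC.
  by rewrite !mulmxA.
pose L1 : {scalar mxpair R n p} := L \o congr_pair (cst H).
have L1E u : L1 u = s^-1 * (v^T *m (ev u.1 + mu *: ev u.2) *m v) 0 0.
  rewrite /= congrE HSH -scalemxAl linearZ /= mxtrace_mulC trace_rank1//.
have [_ Le pure] := pureL.
have L1L u : L1 u = L1 e * L u.
  apply: (pure L1 1) => [{}u Mu|{}u Mu]; first exact/Lpos/sym_qm_congr.
  have := Lpos (sym_qm_congr (cst (1%:M - H)) Mu).
  suff -> : L (congr_pair (cst (1%:M - H)) u) = L u - L1 u.
    by rewrite subr_ge0 mul1r.
  rewrite /= !congrE (state_trace_at _ S1) -linearB -mulmxBl.
  congr (\tr (_ *m _)); rewrite HSH linearB /= trmx1 mulmxBl mul1mx.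
  by rewrite mulmxBr mulmx1 mulmxBl SH HSH HS subrr subr0.
(* This constant is the squared norm of [v]; [s] clears the factor [s^-1] in [L1]. *)
exists mu, v, (s * L1 e); split=> //.
  rewrite pmulr_rgt0// L1E /= /ev map_mx0 scaler0 addr0 map_scalar_mx rmorph1 mulmx1.
  by rewrite mulr_gt0 ?invr_gt0// dot_gt0.
by move=> u; rewrite -mulrA -L1L L1E mulrA mulfV ?mul1r// gt_eqF.
Qed.

End PureStateOfPencils.

(** * Separation of F and contradiction at the point found *)

Theorem theorem6p4 (R : realType) (n p m : nat) (q : 'I_m -> nat)
  (F0 F1 : 'M[{mpoly R[n]}]_p) (G0 G1 : forall i : 'I_m, 'M[{mpoly R[n]}]_(q i))
  (F := pencil F0 F1) (G := fun i : 'I_m => pencil (G0 i) (G1 i)) :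
  F^T = F ->
  (forall i : 'I_m, (G i)^T = G i) ->
  restricted_archimedean G p ->
  (forall (x : 'rV[R]_n) (l : R), semialg_set G (x, l) -> pd (eval_mx x l F)) ->
  restricted_qm G F.
Proof.
move=> /pencil_sym[sF0 sF1] sG arch pdF; apply: contrapT => notF.
have {}notF : ~ sym_qm G (F0, F1) by rewrite sym_qm_sym.
have [L pureL Lle0] := pure_separation (sym_qm_cone G p) (sym_qm_unit arch)
  (@elementary_pair_generating R n p) notF.
have [mu [v [c [v0 c0 S1 LE]]]] := pure_state_is_vector_state arch pureL.
have inK : semialg_set G (point L, mu).
  move=> i; have [sG0 sG1] := pencil_sym (sG i).
  exact: (localizing_psd arch pureL S1 sG0 sG1).
have [_ /(_ v v0)] := pdF _ _ inK.
by rewrite eval_pencil -(LE (F0, F1)) ltNge pmulr_rle0// Lle0.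
Qed.
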